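(* Let $A\in\mathbb{R}^{n\times n}$ be symmetric and let $\hat A\in\mathbb{R}^{n\times n}$ be any matrix. If $u^*$ is a unit eigenvector of $A$, i.e. $Au^*=\lambda^*u^*$ and $\|u^*\|=1$, and $\hat A-\lambda^*I$ is invertible, then $u^*$ is a fixed point of the Error-Powered Sketched Inverse Iteration $$u\longmapsto\frac{(\hat A-\lambda(u)I)^{-1}(\hat A-A)u}{\|(\hat A-\lambda(u)I)^{-1}(\hat A-A)u\|},\qquad \lambda(u)=\frac{u^\top Au}{u^\top u}.$$
   Context: $\|\cdot\|$ is the Euclidean norm. $\hat A$ plays the role of an approximation to $A$, with no assumption on its quality. *)

(* Defs.v *)
From mathcomp Require Import all_boot all_order all_algebra.
From mathcomp Require Import reals.

Set Implicit Arguments.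
Unset Strict Implicit.
Unset Printing Implicit Defensive.

Import GRing.Theory.
Local Open Scope ring_scope.

(* The Euclidean norm on R^n; the norm that MathComp-Analysis puts on matrices
   is the sup norm. *)
Definition enorm (R : realType) (n : nat) (u : 'cV[R]_n) : R :=
  Num.sqrt (\sum_(i < n) u i 0 ^+ 2).

(* u^T A u and u^T u are 1 x 1 matrices, read as scalars through their entry. *)
Definition rayleigh (R : realType) (n : nat) (A : 'M[R]_n) (u : 'cV[R]_n) : R :=
  (u^T *m A *m u) 0 0 / (u^T *m u) 0 0.

(* epsii: Error-Powered Sketched Inverse Iteration. *)
Definition epsii_dir (R : realType) (n : nat) (A Ahat : 'M[R]_n)
    (u : 'cV[R]_n) : 'cV[R]_n :=
  invmx (Ahat - (rayleigh A u)%:M) *m ((Ahat - A) *m u).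

Definition epsii_step (R : realType) (n : nat) (A Ahat : 'M[R]_n)
    (u : 'cV[R]_n) : 'cV[R]_n :=
  (enorm (epsii_dir A Ahat u))^-1 *: epsii_dir A Ahat u.

(* The iteration is a partial map, while invmx and ^-1 are total (invmx M = M
   when M is singular, 0^-1 = 0). This is its natural domain: the Rayleigh
   quotient, the inverse and the normalization are all meaningful at u. *)
Definition epsii_defined (R : realType) (n : nat) (A Ahat : 'M[R]_n)
    (u : 'cV[R]_n) : Prop :=
  [/\ (u^T *m u) 0 0 != 0,
      Ahat - (rayleigh A u)%:M \in unitmx
    & enorm (epsii_dir A Ahat u) != 0].

Definition epsii_fixed_point (R : realType) (n : nat) (A Ahat : 'M[R]_n)
    (u : 'cV[R]_n) : Prop :=
  epsii_defined A Ahat u /\ epsii_step A Ahat u = u.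

(* Main.v *)
Require Import Defs.
From mathcomp Require Import all_boot all_order all_algebra.
From mathcomp Require Import reals.

Import GRing.Theory Num.Theory.
Local Open Scope ring_scope.

(** At a unit eigenvector the Rayleigh quotient equals the eigenvalue, and [A] acts as that scalar,
    so the error [Ahat - A] acts as the shifted matrix [Ahat - lambda%:M]. The inverse cancels it:
    the direction is already the eigenvector ([epsii_dir_eigenvector]), and normalization divides by
    1. *)

Lemma dotmx_enorm (R : realType) (n : nat) (u : 'cV[R]_n) :
  (u^T *m u) 0 0 = enorm u ^+ 2.
Proof.
rewrite /enorm sqr_sqrtr; last by apply: sumr_ge0 => i _; exact: sqr_ge0.
by rewrite mxE; apply: eq_bigr => i _; rewrite mxE expr2.
Qed.

Lemma rayleigh_eigenvector (R : realType) (n : nat) (A : 'M[R]_n)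
    (u : 'cV[R]_n) (lambda : R) :
  A *m u = lambda *: u -> (u^T *m u) 0 0 != 0 -> rayleigh A u = lambda.
Proof.
by move=> eig uu0; rewrite /rayleigh -mulmxA eig -scalemxAr mxE mulfK.
Qed.

Lemma epsii_dir_eigenvector (R : realType) (n : nat) (A Ahat : 'M[R]_n)
    (u : 'cV[R]_n) (lambda : R) :
  A *m u = lambda *: u -> (u^T *m u) 0 0 != 0 ->
  Ahat - lambda%:M \in unitmx -> epsii_dir A Ahat u = u.
Proof.
move=> eig uu0 inv; rewrite /epsii_dir (rayleigh_eigenvector _ _ _ _ _ eig) //.
(* Reading [lambda *: u] as [lambda%:M *m u] exposes the factor that the inverse cancels. *)
by rewrite mulmxBl eig -mul_scalar_mx -mulmxBl mulKmx.
Qed.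

Theorem lemma1 (R : realType) (n : nat) (A Ahat : 'M[R]_n)
    (ustar : 'cV[R]_n) (lambdastar : R)
    (A_sym : A^T = A)
    (eig : A *m ustar = lambdastar *: ustar)
    (unit_norm : enorm ustar = 1)
    (inv : Ahat - lambdastar%:M \in unitmx) :
  epsii_fixed_point A Ahat ustar.
Proof.
have uu0 : (ustar^T *m ustar) 0 0 != 0.
  by rewrite dotmx_enorm unit_norm expr1n oner_neq0.
have dirE := epsii_dir_eigenvector _ _ _ _ _ _ eig uu0 inv.
split; last by rewrite /epsii_step dirE unit_norm invr1 scale1r.
split=> //; last by rewrite dirE unit_norm oner_neq0.
(* The domain condition shifts by the Rayleigh quotient, [inv] by [lambdastar]; the two shifts
   agree. *)
by rewrite (rayleigh_eigenvector _ _ _ _ _ eig).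
Qed.
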